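(* Let $\mathcal{T}_n \subset 2^{X}$, where $X=\binom{[n]}{2}$ is the edge set of the complete graph on $[n]$, be the down-set of all triangle-free graphs on the vertex set $[n]$. Then the expectation-threshold satisfies $q(\mathcal{T}_n)=\Omega(1/\sqrt{n})$ and $q(\mathcal{T}_n)=O(\sqrt{\log n/n})$, the fractional expectation-threshold satisfies $q_f(\mathcal{T}_n)=\Omega(1/\sqrt{n})$ and $q_f(\mathcal{T}_n)=O(\sqrt{\log n/n})$, while the threshold satisfies $p_c(\mathcal{T}_n)=\Theta(1/n)$.
   Context: For a finite set $X$ and $p\in[0,1]$, $\mu_p$ is the product measure on $2^X$ with $\mu_p(S)=p^{|S|}(1-p)^{|X\setminus S|}$. A family $\mathcal{F}\subset 2^X$ is a down-set if it is closed under taking subsets. For a non-trivial (not $\emptyset$ or $2^X$) down-set $\mathcal{F}$, the threshold $p_c(\mathcal{F})$ is the unique $p$ with $\mu_p(\mathcal{F})=1/2$. A down-set $\mathcal{F}$ is $p$-small if there is $\mathcal{G}\subset 2^X$ such that every member of $\mathcal{F}$ is a subset of some member of $\mathcal{G}$ and $\sum_{S\in\mathcal{G}}(1-p)^{|X\setminus S|}\le 1/2$; the expectation-threshold $q(\mathcal{F})$ is the smallest $p\in[0,1]$ for which $\mathcal{F}$ is $p$-small. A down-set $\mathcal{F}$ is weakly $p$-small if there is $g:2^X\to\mathbb{R}_{\ge0}$ with $\sum_{T\supseteq S}g(T)\ge 1$ for every $S\in\mathcal{F}$ and $\sum_{T\subseteq X}g(T)(1-p)^{|X\setminus T|}\le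 1/2$; the fractional expectation-threshold $q_f(\mathcal{F})$ is the smallest $p\in[0,1]$ for which $\mathcal{F}$ is weakly $p$-small. Asymptotic notation is as $n\to\infty$. *)

(* Defs.v *)
From mathcomp Require Import all_boot all_order all_algebra.
From mathcomp Require Import all_classical all_reals all_analysis.

Set Implicit Arguments.
Unset Strict Implicit.
Unset Printing Implicit Defensive.
Import Order.TTheory GRing.Theory Num.Theory.
Import numFieldNormedType.Exports.

Local Open Scope ring_scope.

Section Thresholds.
Variables (R : realType) (X : finType).
Implicit Types (p : R) (S T : {set X}) (F G : {set {set X}}).

Definition down_set F := forall S T, T \subset S -> S \in F -> T \in F.

Definition mu p F : R := \sum_(S in F) p ^+ #|S| * (1 - p) ^+ #|~: S|.

Definition p_small F p :=
  exists G : {set {set X}},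
    (forall S, S \in F -> exists2 T, T \in G & S \subset T) /\
    \sum_(S in G) (1 - p) ^+ #|~: S| <= 2^-1.

Definition weakly_p_small F p :=
  exists g : {set X} -> R,
    [/\ forall T, 0 <= g T,
        forall S, S \in F -> 1 <= \sum_(T : {set X} | S \subset T) g T
      & \sum_(T : {set X}) g T * (1 - p) ^+ #|~: T| <= 2^-1].

Local Open Scope classical_set_scope.

(* [xget 0 P] is an element of [P] whenever there is one. For a non-trivial
   down-set the three sets below are singletons, so that the default value 0
   plays no role. *)
Definition threshold F : R :=
  xget 0 [set p | 0 <= p <= 1 /\ mu p F = 2^-1].

Definition least (A : set R) : R := xget 0 (A `&` lbound A).

Definition expectation_threshold F : R :=
  least [set p | 0 <= p <= 1 /\ p_small F p].

Definition fractional_expectation_threshold F : R :=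
  least [set p | 0 <= p <= 1 /\ weakly_p_small F p].

End Thresholds.

Arguments threshold R {X} F.
Arguments expectation_threshold R {X} F.
Arguments fractional_expectation_threshold R {X} F.

Definition edge (n : nat) := {e : {set 'I_n} | #|e| == 2%N}.

Definition adj n (S : {set edge n}) (x y : 'I_n) :=
  [set x; y]%SET \in [set val e | e in S]%SET.

Definition triangle_free n : {set {set edge n}} :=
  [set S : {set edge n} |
    ~~ [exists x, exists y, exists z,
          [&& adj S x y, adj S y z & adj S x z]]]%SET.

Lemma adj_neq n (S : {set edge n}) x y : adj S x y -> x != y.
Proof.
case/imsetP => e _ eE; have /eqP := valP e; rewrite -eE.
by apply: contra_eqN => /eqP ->; rewrite finset.setUid cards1.
Qed.

Lemma triangle_free_down_set n : down_set (triangle_free n).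
Proof.
move=> S T TS; rewrite !inE; apply: contra.
have h x y : adj T x y -> adj S x y by apply: (fintype.subsetP (imsetS val TS)).
case/existsP => x /existsP[y /existsP[z /and3P[xy yz xz]]].
by apply/existsP; exists x; apply/existsP; exists y; apply/existsP; exists z;
  rewrite !h.
Qed.

Lemma triangle_free_neq0 n : triangle_free n != finset.set0.
Proof.
apply/finset.set0Pn; exists finset.set0; rewrite inE.
apply/negP => /existsP[x /existsP[y /existsP[z /and3P[/imsetP[e]]]]].
by rewrite inE.
Qed.

Lemma triangle_free_neqT n : (2 < n)%N -> triangle_free n != [set: _]%SET.
Proof.
case: n => [|[|[|n]]] // _; apply/eqP => /setP /(_ [set: _]%SET).
rewrite !inE => /negP; apply.
have adjT (x y : 'I_n.+3) : x != y -> adj [set: edge n.+3]%SET x y.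
  move=> xy; have xy2 : #|[set x; y]%SET| == 2%N by rewrite cards2 xy.
  by apply/imsetP; exists (Sub [set x; y]%SET xy2 : edge n.+3);
    rewrite ?inE ?SubK.
apply/existsP; exists (inord 0); apply/existsP; exists (inord 1).
apply/existsP; exists (inord 2).
by rewrite !adjT // -val_eqE /= !inordK.
Qed.

(* Main.v *)
(* Triangle-free graphs are the edge sets that contain no member of a linear
   3-uniform hypergraph (the triangles) of degree at most n on the edges of K_n.

   Lower bound for q_f: draw G from mu_p with p = 1/(4 sqrt n) and delete the
   edges of a maximal family of edge-disjoint triangles of G. A union bound over
   the deleted triangles that meet H shows that the resulting triangle-free
   graph misses H with probability at most (1 - p/2)^|H|, for every H; averaging
   a fractional cover over this random graph gives the bound.

   Upper bound for q: a triangle-free graph has an independent set of order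
   sqrt(n log n) (a neighbourhood, or else a random independent set is large on
   average), so the complements of the cliques of that order form a cover.

   The threshold p_c follows from the union bound and from the second moment
   method applied to the number of triangles. *)
Require Import Defs.
From mathcomp Require Import all_boot all_order all_algebra.
From mathcomp Require Import all_classical all_reals all_analysis.
From mathcomp Require Import ring lra zify.
Set Implicit Arguments.
Unset Strict Implicit.
Unset Printing Implicit Defensive.
Import Order.TTheory GRing.Theory Num.Theory.
Import numFieldNormedType.Exports.
Local Open Scope ring_scope.

(** * The product measure, union bound, and duality for fractional covers *)

Section ProductMeasure.
Import mathcomp.boot.fintype mathcomp.boot.finset.
Variables (R : realType) (X : finType).
Implicit Types (p q : R) (A B G H S T : {set X}) (F : {set {set X}}).

Lemma prod_if_in p q S :
  \prod_i (if i \in S then p else q) = p ^+ #|S| * q ^+ #|~: S|.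
Proof.
rewrite (bigID (mem S)) /=; congr (_ * _).
  by rewrite (eq_bigr (fun=> p)) ?prodr_const // => i ->.
rewrite (eq_bigr (fun=> q)) => [|i /negbTE -> //].
by rewrite prodr_const; congr (_ ^+ _); apply: eq_card => i; rewrite !inE.
Qed.

Lemma prod_if_in1 p S : \prod_i (if i \in S then p else 1) = p ^+ #|S|.
Proof. by rewrite prod_if_in expr1n mulr1. Qed.

Lemma sum_subset_exp (x : R) A :
  \sum_(M : {set X} | M \subset A) x ^+ #|M| = (1 + x) ^+ #|A|.
Proof.
pose f i := if i \in A then x else 0.
transitivity (\prod_i (f i + 1)); last first.
  rewrite -prod_if_in1.
  by apply: eq_bigr => i _; rewrite /f; case: ifP => _; rewrite addrC ?addr0 // add0r.
rewrite bigA_distr big_mkcond; apply: eq_bigr => M _ /=.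
case: ifPn => [/subsetP MA | /subsetPn[i iM iA]]; last first.
  by rewrite (bigD1 i) //= iM /f (negbTE iA) mul0r.
rewrite -prod_if_in1.
by apply: eq_bigr => i _; case: ifP => // /MA; rewrite /f => ->.
Qed.

(** The sum factors over the points of [X]: the factor is [p] on [A], [1 - p] on [B] and
    [p + (1 - p) = 1] elsewhere. *)
Lemma mu_cylinder p A B : [disjoint A & B] ->
  mu p [set S : {set X} | (A \subset S) && [disjoint S & B]] =
    p ^+ #|A| * (1 - p) ^+ #|B|.
Proof.
move=> dAB; pose f i := if i \in B then 0 else p.
pose g i := if i \in A then 0 else 1 - p.
transitivity (\prod_i (f i + g i)); last first.
  rewrite -2!prod_if_in1 -big_split /=.
  apply: eq_bigr => i _; rewrite /f /g; case: ifP => iB; case: ifP => iA;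
    rewrite ?add0r ?addr0 ?mulr1 ?mul1r //; last by rewrite addrC subrK.
  by move/disjoint_setI0/setP/(_ i): dAB; rewrite !inE iA iB.
rewrite bigA_distr /mu big_mkcond; apply: eq_bigr => S _ /=.
rewrite inE; case: ifPn => [/andP[/subsetP AS SB]|].
  rewrite -prod_if_in; apply: eq_bigr => i _; case: ifPn => iS.
    by rewrite /f (disjointFr SB iS).
  by rewrite /g (contraNF (AS i) iS).
rewrite negb_and => /orP[/subsetPn[i iA iS]|/pred0Pn[i /andP[/= iS iB]]].
  by rewrite (bigD1 i) //= (negbTE iS) /g iA mul0r.
by rewrite (bigD1 i) //= iS /f iB mul0r.
Qed.

Lemma mu_setT p : mu p [set: {set X}] = 1.
Proof.
have d0 : [disjoint (set0 : {set X}) & set0] by rewrite -setI_eq0 setI0.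
have := @mu_cylinder p set0 set0 d0.
rewrite cards0 !expr0 mulr1 => <-; congr (mu _ _); apply/setP => S.
by rewrite !inE sub0set -setI_eq0 setI0 eqxx.
Qed.

Lemma mu_supset p A : mu p [set S : {set X} | A \subset S] = p ^+ #|A|.
Proof.
have dA : [disjoint A & set0] by rewrite -setI_eq0 setI0.
rewrite -[RHS]mulr1 -(expr0 (1 - p)) -(cards0 X) -(mu_cylinder p dA).
by congr (mu _ _); apply/setP => S; rewrite !inE -setI_eq0 setI0 eqxx andbT.
Qed.

Lemma weight_ge0 p S : 0 <= p <= 1 -> 0 <= p ^+ #|S| * (1 - p) ^+ #|~: S|.
Proof.
by case/andP => p0 p1; rewrite mulr_ge0 ?exprn_ge0 // subr_ge0.
Qed.

(** The union bound. *)
Lemma mu_le_sum p F (I : finType) (P : pred I) (E : I -> {set {set X}}) :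
  0 <= p <= 1 -> (forall S, S \in F -> exists2 i, P i & S \in E i) ->
  mu p F <= \sum_(i | P i) mu p (E i).
Proof.
move=> p01 FE; rewrite /mu; under [leRHS]eq_bigr do rewrite big_mkcond /=.
rewrite exchange_big /= [leLHS]big_mkcond /=; apply: ler_sum => S _.
have nn i : P i -> 0 <= if S \in E i then p ^+ #|S| * (1 - p) ^+ #|~: S| else 0.
  by case: ifP => // _ _; exact: weight_ge0.
case: ifP => [/FE[i Pi SEi]|_]; last exact: sumr_ge0.
rewrite (bigD1 i) //= SEi lerDl; apply: sumr_ge0 => j /andP[Pj _]; exact: nn.
Qed.

(* Duality: a random member of [F] that meets every set [H] with probability
   at least [1 - (1 - p)^|H|] rules out a fractional cover of [F]. *)
Lemma not_weakly_p_small p q F (phi : {set X} -> {set X}) :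
  0 <= q <= 1 -> (forall G, phi G \in F) ->
  (forall H, mu q [set G : {set X} | [disjoint phi G & H]] <= (1 - p) ^+ #|H|) ->
  ~ weakly_p_small F p.
Proof.
move=> q01 phiF phiH [g [g0 gF gp]].
suff: (1 : R) <= 2^-1 by lra.
apply: le_trans gp; rewrite -[leLHS](mu_setT q) /mu.
have wE G : \sum_(T : {set X} | phi G \subset T) q ^+ #|G| * (1 - q) ^+ #|~: G| * g T >=
    q ^+ #|G| * (1 - q) ^+ #|~: G|.
  rewrite -big_distrr /= ler_peMr ?weight_ge0 //; exact: gF.
apply: (le_trans (ler_sum _ (fun G _ => wE G))) => /=.
under eq_bigr do rewrite big_mkcond /=.
(* After the exchange of sums, [phi G] lies inside [T] exactly when it misses [~: T], so [phiH] at
   [~: T] bounds the inner sum. *)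
rewrite exchange_big /=; apply: ler_sum => T _.
apply: le_trans (ler_wpM2l (g0 T) (phiH (~: T))).
rewrite /mu mulr_sumr [leRHS]big_mkcond /= [leLHS]big_mkcond /=.
apply: ler_sum => G _; rewrite !inE disjoints_subset setCK.
by case: ifP => // _; rewrite mulrC.
Qed.

End ProductMeasure.

(** * Sets avoiding a 3-uniform hypergraph of bounded degree *)

Section Hypergraph.
Import mathcomp.boot.fintype mathcomp.boot.finset.
Variables (R : realType) (X : finType) (E : {set {set X}}) (D : nat).
Hypothesis uniE : forall t, t \in E -> #|t| = 3%N.
Hypothesis degE : forall x, (#|[set t in E | x \in t]| <= D)%N.
Implicit Types (p q x : R) (s t G H S : {set X}) (M : {set {set X}}).

Definition avoiding := [set S : {set X} | [forall t in E, ~~ (t \subset S)]].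

(** Double counting of the incidences between members of [E] and points of [H]. *)
Lemma card_meeting H :
  (#|[set t in E | ~~ [disjoint t & H]]| <= D * #|H|)%N.
Proof.
rewrite -sum1_card big_mkcond /=.
apply: (@leq_trans (\sum_(t in E) \sum_(x in H) (x \in t))%N).
  rewrite [leqRHS]big_mkcond /=; apply: leq_sum => t _; rewrite inE.
  case: ifP => // /andP[-> /pred0Pn[x /andP[/= xt xH]]].
  by rewrite (bigD1 x) //= xt.
rewrite exchange_big /= mulnC -sum_nat_const; apply: leq_sum => x _.
apply: leq_trans (degE x); rewrite -sum1_card big_mkcond [leqRHS]big_mkcond /=.
by apply: leq_sum => t _; rewrite inE; case: (t \in E) => //=; case: (x \in t).
Qed.

(** Take [M] inclusion-maximal: a member of [E] inside [G :\: cover M] would be disjoint from all of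
    [M] and could be added to it. *)
Lemma maximal_packing G : exists M,
  [/\ trivIset M, M \subset E, cover M \subset G & G :\: cover M \in avoiding].
Proof.
pose P M := [&& trivIset M, M \subset E & cover M \subset G].
have P0 : P set0.
  by rewrite /P /trivIset /cover !big_set0 cards0 !sub0set eqxx.
have [M maxM _] := maxset_exists P0.
have /and3P[tM ME MG] := maxsetp maxM.
exists M; split => //; rewrite inE; apply/forall_inP => t tE; apply/negP => tGM.
have tM0 : [disjoint t & cover M].
  by move: tGM; rewrite subsetD => /andP[].
have dtM : {in M, forall B : {set X}, [disjoint t & B]}.
  move=> B BM; apply: disjointWr tM0; exact: (bigcup_max B).
have nM0 : set0 \notin M.
  by apply/negP => /(subsetP ME)/uniE; rewrite cards0.
have [tM' tNM] := trivIsetU1 dtM tM nM0.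
have /(maxsetsup maxM) /(_ (subsetUr _ _)) MtM : P (t |: M).
  rewrite /P tM' subUset sub1set tE ME /cover bigcup_setU big_set1 subUset.
  by move: tGM; rewrite subsetD => /andP[-> _]; exact: MG.
by move: tNM; rewrite -MtM setU11.
Qed.

(* If [G :\: cover M] misses [H], then the edges of the packing [M] that meet
   [H] cover [G :&: H]; summing over the possible sets of such edges gives the
   second factor. *)
Lemma packing_removal p : 0 < p < 1 ->
  exists phi : {set X} -> {set X},
    (forall G, phi G \in avoiding) /\
    forall H, mu p [set G : {set X} | [disjoint phi G & H]] <=
      (1 - p) ^+ #|H| * (1 + (p / (1 - p)) ^+ 3) ^+ (D * #|H|).
Proof.
move=> /andP[p0 p1]; have [m mP] := fin_all_exists maximal_packing.
exists (fun G => G :\: cover (m G)); split=> [G|H]; first by case: (mP G).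
have q0 : 0 < 1 - p by rewrite subr_gt0.
(* [x] is the price of one member of the packing: its three points must be present, and at most
   three points of [H] are thereby excused from being absent. *)
set x := (p / (1 - p)) ^+ 3; have x0 : 0 <= x by rewrite exprn_ge0 ?divr_ge0 ?ltW.
set EH := [set t in E | ~~ [disjoint t & H]].
pose cyl M := [set G : {set X} |
  (cover M \subset G) && [disjoint G & H :\: cover M]].
have cylP S : S \in [set G : {set X} | [disjoint G :\: cover (m G) & H]] ->
    exists2 M : {set {set X}}, (M \subset EH) && trivIset M & S \in cyl M.
  rewrite inE => dSH; have [tM ME MS _] := mP S.
  pose M := [set t in m S | ~~ [disjoint t & H]]; exists M.
    apply/andP; split; last by apply: trivIsetS tM; apply/subsetP => t /setIdP[].
    by apply/subsetP => t; rewrite !inE => /andP[/(subsetP ME) -> ->].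
  rewrite inE; apply/andP; split.
    apply: subset_trans MS; apply/bigcupsP => t /setIdP[tM' _].
    exact: (bigcup_max t).
  rewrite disjoints_subset; apply/subsetP => y yS; rewrite !inE negb_and negbK.
  apply/orP; case: (boolP (y \in H)) => yH; [left | by right].
  have : y \notin S :\: cover (m S) by apply: contraL yH => /(disjointFr dSH) ->.
  rewrite inE yS andbT negbK => /bigcupP[t tM' yt].
  apply/bigcupP; exists t => //; rewrite inE tM' /=.
  by apply/pred0Pn; exists y; rewrite /= yt yH.
apply: le_trans (mu_le_sum _ cylP) _; first by rewrite !ltW.
apply: (@le_trans _ _ ((1 - p) ^+ #|H| * (1 + x) ^+ #|EH|)); last first.
  apply: ler_wpM2l; first by rewrite exprn_ge0 // ltW.
  by apply: ler_weXn2l; [rewrite lerDl | exact: card_meeting].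
rewrite -sum_subset_exp mulr_sumr big_mkcond [leRHS]big_mkcond /=.
apply: ler_sum => M _; case: ifP => [/andP[MEH tM]|_]; last first.
  by case: ifP => _ //; apply: mulr_ge0; apply: exprn_ge0 => //; exact: ltW.
rewrite MEH mu_cylinder; last first.
  by rewrite disjoint_sym disjoints_subset; apply/subsetP => y /setDP[_]; rewrite inE.
have cM : #|cover M| = (3 * #|M|)%N.
  rewrite -(eqP tM) mulnC -sum_nat_const; apply: eq_bigr => t tM'.
  by move/(subsetP MEH): tM'; rewrite inE => /andP[/uniE].
have HM : (#|H| <= #|H :\: cover M| + #|cover M|)%N.
  rewrite -[leqLHS](cardsID (cover M) H) addnC leq_add2l subset_leq_card //.
  exact: subsetIr.
rewrite /x -exprM -cM expr_div_n mulrCA.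
apply: ler_wpM2l; first by rewrite exprn_ge0 // ltW.
by rewrite ler_pdivlMr ?exprn_gt0 // -exprD ler_wiXn2l ?lerBlDr ?lerDl // ltW.
Qed.

Lemma exp_onem_ge x n : 0 <= x <= 1 -> 1 - n%:R * x <= (1 - x) ^+ n.
Proof.
move=> /andP[x0 x1]; elim: n => [|n IHn]; first by rewrite mul0r subr0.
have y0 : 0 <= 1 - x by lra.
rewrite exprS; apply: le_trans (ler_wpM2l y0 IHn).
have : 0 <= n%:R * x * x by rewrite !mulr_ge0.
rewrite -natr1; lra.
Qed.

(** With [x] the cube, [q / (1 - q) <= 2 * q] gives [D * x <= q / 2]. Then [(1 + x) ^ D] is at most
    the inverse of [(1 - x) ^ D], hence of [1 - q / 2], and [1 - q <= (1 - q / 2) ^ 2] concludes. *)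
Lemma onem_exp_bound q : 0 < q <= 2^-1 -> 16 * D%:R * q ^+ 2 <= 1 ->
  (1 - q) * (1 + (q / (1 - q)) ^+ 3) ^+ D <= 1 - q / 2.
Proof.
move=> /andP[q0 q1] Dq; set x := (_ / _) ^+ 3.
have r0 : 0 <= q / (1 - q) by rewrite divr_ge0; lra.
have r2 : q / (1 - q) <= 2 * q by rewrite ler_pdivrMr; nra.
have r1 : q / (1 - q) <= 1 by lra.
have x01 : 0 <= x <= 1 by rewrite exprn_ge0 ?exprn_ile1.
have xq : x <= (2 * q) ^+ 3 by rewrite /x lerXn2r ?nnegrE //; lra.
have Dx : D%:R * x <= q / 2.
  apply: le_trans (ler_wpM2l (ler0n R D) xq) _.
  have -> : D%:R * (2 * q) ^+ 3 = (16 * D%:R * q ^+ 2) * (q / 2) by field.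
  by rewrite ler_piMl //; lra.
have y0 : 0 < (1 + x) ^+ D by rewrite exprn_gt0; lra.
have xx : (1 + x) ^+ D * (1 - x) ^+ D <= 1.
  by rewrite -exprMn exprn_ile1; nra.
have b : (1 + x) ^+ D * (1 - q / 2) <= 1.
  apply: le_trans xx; rewrite ler_pM2l //.
  apply: le_trans (exp_onem_ge D x01); lra.
rewrite -/x; set y := (1 + x) ^+ D in y0 xx b *.
have h0 : 0 < 1 - q / 2 by lra.
rewrite -(ler_pM2r h0) -mulrA.
apply: (@le_trans _ _ ((1 - q) * 1)); first by rewrite ler_wpM2l //; lra.
nra.
Qed.

Lemma avoiding_not_weakly_small q p : 0 < q <= 2^-1 ->
  16 * D%:R * q ^+ 2 <= 1 -> p <= q / 2 -> ~ weakly_p_small avoiding p.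
Proof.
move=> /andP[q0 q1] Dq pq.
have q01 : 0 < q < 1 by apply/andP; split; lra.
have [phi [phiE phiH]] := packing_removal q01.
apply: (@not_weakly_p_small _ _ _ q _ phi) => // [|H]; first by lra.
apply: le_trans (phiH H) _; rewrite exprM -exprMn.
apply: lerXn2r; rewrite ?nnegrE.
- have q1' : 0 <= 1 - q by lra.
  by rewrite mulr_ge0 // exprn_ge0 // addr_ge0 // exprn_ge0 // divr_ge0 // ltW.
- lra.
- apply: le_trans (onem_exp_bound _ Dq) _; lra.
Qed.

(** First moment: a set outside [avoiding] contains some member of [E], and each member is contained
    with probability [p ^ 3]. *)
Lemma mu_avoiding_ge p : 0 <= p <= 1 ->
  1 - #|E|%:R * p ^+ 3 <= mu p avoiding.
Proof.
move=> p01; rewrite -[X in X - _](mu_setT X p) lerBlDr.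
have -> : mu p [set: {set X}] = mu p avoiding + mu p (~: avoiding).
  rewrite /mu (bigID (mem avoiding)) /=.
  by congr (_ + _); apply: eq_bigl => S; rewrite !inE.
rewrite lerD2l.
have := @mu_le_sum R X p (~: avoiding) _ (mem E)
  (fun t => [set S : {set X} | t \subset S]) p01.
under eq_bigr => t tE do rewrite mu_supset (uniE tE).
rewrite sumr_const mulr_natl; apply => S; rewrite !inE negb_forall_in.
by case/exists_inP => t tE; rewrite negbK => tS; exists t; rewrite ?inE.
Qed.

Hypothesis linE : {in E &, forall s t, s != t -> (#|s :&: t| <= 1)%N}.

(** Chebyshev's inequality: on [avoiding] the centred number of members of [E] inside [S] equals
    [- #|E| * p ^ 3], so the left side is at most the variance. There disjoint pairs contribute
    nothing, equal pairs at most [p ^ 3], and distinct meeting pairs at most [p ^ 5], since by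
    linearity their union has at least five points. *)
Lemma mu_avoiding_le p : 0 < p <= 1 ->
  (#|E|%:R * p ^+ 3) ^+ 2 * mu p avoiding <=
    #|E|%:R * (p ^+ 3 + 3 * D%:R * p ^+ 5).
Proof.
move=> /andP[p0 p1]; have p01 : 0 <= p <= 1 by rewrite ltW.
pose w S := p ^+ #|S| * (1 - p) ^+ #|~: S|.
pose b t S : R := (t \subset S)%:R - p ^+ 3.
have cov s t : s \in E -> t \in E ->
    \sum_S w S * (b s S * b t S) = p ^+ #|s :|: t| - p ^+ 6.
  have sumw (A : {set X}) : \sum_S w S * (A \subset S)%:R = p ^+ #|A|.
    rewrite -(mu_supset p A) /mu [RHS]big_mkcond; apply: eq_bigr => S _ /=.
    by rewrite inE; case: ifP => _; rewrite ?mulr1 ?mulr0.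
  move=> sE tE.
  (* The constant term of the product is written with the trivial condition [set0 \subset S], so
     that [sumw] evaluates all four terms. *)
  transitivity (\sum_S (w S * (s :|: t \subset S)%:R
    - p ^+ 3 * (w S * (s \subset S)%:R) - p ^+ 3 * (w S * (t \subset S)%:R)
    + p ^+ 6 * (w S * (set0 \subset S)%:R))).
    apply: eq_bigr => S _; rewrite /b subUset sub0set.
    by case: (s \subset S); case: (t \subset S); rewrite /=; ring.
  rewrite big_split /= !sumrB -!mulr_sumr !sumw cards0 (uniE sE) (uniE tE).
  ring.
have covle s t : s \in E -> t \in E -> p ^+ #|s :|: t| - p ^+ 6 <=
    (if t == s then p ^+ 3 else 0) + (if ~~ [disjoint t & s] then p ^+ 5 else 0).
  move=> sE tE; have p6 : 0 <= p ^+ 6 by rewrite exprn_ge0 // ltW.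
  have p5 : 0 <= p ^+ 5 by rewrite exprn_ge0 // ltW.
  have p3 : 0 <= p ^+ 3 by rewrite exprn_ge0 // ltW.
  have [->|ts] := eqVneq t s.
    rewrite setUid (uniE sE); case: ifP => _; lra.
  have := cardsUI s t; rewrite (uniE sE) (uniE tE) => cU.
  case: ifP => [_|/negbFE dts].
    have p45 : p ^+ #|s :|: t| <= p ^+ 5.
      rewrite ler_wiXn2l // ?ltW //.
      have := linE sE tE; rewrite eq_sym ts => /(_ isT); lia.
    lra.
  move: cU; have -> : s :&: t = set0.
    by apply/eqP; rewrite setI_eq0 disjoint_sym.
  rewrite cards0 addn0 => ->; lra.
have w0 S : 0 <= w S by exact: weight_ge0.
apply: (@le_trans _ _ (\sum_S w S * (\sum_(t in E) b t S) ^+ 2)).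
  rewrite /mu mulr_sumr big_mkcond /=; apply: ler_sum => S _.
  case: ifP => [|_]; last by rewrite mulr_ge0 ?sqr_ge0.
  rewrite inE => /forall_inP SE.
  rewrite (eq_bigr (fun=> - p ^+ 3)) => [|t /SE /negbTE]; last first.
    by rewrite /b => ->; rewrite sub0r.
  by rewrite sumr_const mulNrn sqrrN mulr_natl mulrC.
have -> : \sum_S w S * (\sum_(t in E) b t S) ^+ 2 =
    \sum_(s in E) \sum_(t in E) \sum_S w S * (b s S * b t S).
  rewrite [RHS](eq_bigr (fun s => \sum_S \sum_(t in E) w S * (b s S * b t S)));
    last by move=> s _; rewrite exchange_big.
  rewrite exchange_big /=; apply: eq_bigr => S _.
  rewrite expr2 mulr_suml mulr_sumr; apply: eq_bigr => s _.
  by rewrite -mulr_sumr -mulr_sumr.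
rewrite [leRHS]mulr_natl -sumr_const; apply: ler_sum => s sE.
rewrite (eq_bigr _ (fun t tE => cov s t sE tE)).
apply: le_trans (ler_sum _ (fun t tE => covle s t sE tE)) _.
rewrite big_split /= -big_mkcondr -big_mkcondr /=.
rewrite (big_pred1 s) => [|t]; last by rewrite /= andbC; case: (eqVneq t s) => // ->.
(* At most [D * #|s| = 3 * D] members of [E] meet [s]. *)
rewrite lerD2l sumr_const -[leLHS]mulr_natl.
apply: ler_wpM2r; first by rewrite exprn_ge0 // ltW.
rewrite -[3]/(3%:R) -natrM ler_nat mulnC -(uniE sE).
apply: leq_trans (card_meeting s).
by rewrite leq_eqVlt; apply/orP; left; apply/eqP/eq_card => t; rewrite !inE.
Qed.

End Hypergraph.

(** * Large independent sets in triangle-free graphs of bounded degree *)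

Section IndependentSet.
Import mathcomp.boot.fintype mathcomp.boot.finset.
Local Open Scope nat_scope.
Variables (V : finType) (e : rel V) (d l : nat).
Hypothesis symE : symmetric e.
Hypothesis triangleE : forall x y z, e x y -> e y z -> e x z -> False.
Hypothesis degE : forall x, #|[set y | e x y]| <= d.
Hypothesis ld : 4 ^ l <= d.
Implicit Types (v : V) (W Y Z A B : {set V}).

Definition independent W := [forall x in W, forall y in W, ~~ e x y].

Lemma independentP W :
  reflect {in W &, forall x y, ~~ e x y} (independent W).
Proof.
apply: (iffP forall_inP) => [h x y xW yW | h x xW].
  exact: (forall_inP (h x xW)).
by apply/forall_inP => y yW; apply: h.
Qed.

Lemma independentS W Z : Z \subset W -> independent W -> independent Z.
Proof.
move=> /subsetP ZW /independentP h; apply/independentP => x y /ZW xW /ZW yW.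
exact: h.
Qed.

(** Pair each [Y] with its complement [A :\: Y]. *)
Lemma sum_card_subset A : (\sum_(Y : {set V} | Y \subset A) #|Y|) * 2 =
  #|A| * 2 ^ #|A|.
Proof.
rewrite muln2 -addnn.
have {2}-> : \sum_(Y : {set V} | Y \subset A) #|Y| =
    \sum_(Y : {set V} | Y \subset A) #|A :\: Y|.
  rewrite (reindex_onto (fun Y => A :\: Y) (fun Y => A :\: Y)) /=; last first.
    by move=> Y YA; rewrite setDDr setDv set0U; apply/setIidPr.
  apply: eq_bigl => Y; rewrite subsetDl /= setDDr setDv set0U.
  by apply/eqP/idP => [<-|/setIidPr //]; exact: subsetIl.
rewrite -big_split /= -card_powerset mulnC -sum_nat_const.
apply: eq_big => [Y|Y /setIidPr AY]; first by rewrite powersetE.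
by rewrite -(cardsID Y A) AY.
Qed.

(** Here [a] counts the usable neighbours of a vertex, and [2 ^ a + 1] the independent sets with a
    given outside part. If [a >= l] the second term suffices; otherwise [2 ^ a + 1 <= 2 ^ l] and
    [l * 2 ^ l <= 4 ^ l <= d]. *)
Lemma neighbour_weight_bound a : l * (2 ^ a + 1) <= 4 * d + 2 * (a * 2 ^ a).
Proof.
have a1 : 0 < 2 ^ a by rewrite expn_gt0.
case: (leqP l a) => la.
  have : l * 2 ^ a <= a * 2 ^ a by rewrite leq_mul2r la orbT.
  have : l <= l * 2 ^ a by rewrite leq_pmulr.
  lia.
have : 2 ^ a.+1 <= 2 ^ l by rewrite leq_exp2l.
have : l * 2 ^ l <= 2 ^ l * 2 ^ l by rewrite leq_mul2r ltnW ?orbT // ltn_expl.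
rewrite -expnMn => ll al; move: (leq_trans ll ld) => h.
have : l * (2 ^ a + 1) <= l * 2 ^ l.
  by rewrite leq_mul2l; move: al; rewrite expnS; lia.
lia.
Qed.

(* Condition on the part [Z] of a uniform random independent set [W] that lies
   outside [v] and its neighbourhood: what remains is either [v] alone or an
   arbitrary set of neighbours of [v] that have no neighbour in [Z]. *)
Lemma sum_neighbour_weight v :
  l * #|[set W | independent W]| <=
    4 * \sum_(W in [set W | independent W]) (d * (v \in W) + #|[set y | e v y] :&: W|).
Proof.
set N := [set y | e v y]; set B := v |: N.
have vN : v \notin N by rewrite inE; apply/negP => vv; exact: (triangleE vv vv).
have NI : independent N.
  apply/independentP => x y; rewrite !inE => vx vy.
  by apply/negP => /(triangleE vx); exact.
rewrite -sum1_card !big_distrr /=.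
rewrite (partition_big (fun W => W :\: B) xpredT) //=.
rewrite [leqRHS](partition_big (fun W => W :\: B) xpredT) //=.
apply: leq_sum => Z _.
(* If [Z] is the outside part of no independent set, both inner sums are empty; otherwise [Z] is
   itself independent. *)
case: (pickP (fun W : {set V} => (W \in [set W | independent W]) && (W :\: B == Z)));
  last by move=> h; rewrite !big_pred0.
move=> W0; rewrite inE => /andP[W0I /eqP W0Z].
have ZI : independent Z by apply: independentS W0I; rewrite -W0Z subsetDl.
have ZB x : x \in Z -> (x != v) && (~~ e v x).
  by rewrite -W0Z !inE negb_or => /andP[/andP[-> ->]].
pose A := [set y in N | [forall z in Z, ~~ e y z]].
have fiber (f : {set V} -> nat) :
    \sum_(W | (W \in [set W | independent W]) && (W :\: B == Z)) f W =
    f (v |: Z) + \sum_(Y : {set V} | Y \subset A) f (Z :|: Y).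
  rewrite (bigID (fun W => v \in W)) /=; congr (_ + _).
    apply: big_pred1 => W; rewrite /= inE; apply/idP/eqP => [|->].
      move=> /andP[/andP[/independentP WI /eqP <-] vW]; apply/setP => x.
      rewrite !inE; have [->|xv] := eqVneq x v; first by rewrite vW.
      case: (boolP (x \in W)) => xW; rewrite ?andbF ?andbT //=.
      by rewrite (WI v x).
    rewrite setU11 andbT; apply/andP; split.
      apply/independentP => x y /setU1P[->|xZ] /setU1P[->|yZ].
      - by apply/negP => vv; exact: (triangleE vv vv).
      - by case/andP: (ZB y yZ).
      - by rewrite symE; case/andP: (ZB x xZ).
      - exact: (independentP _ ZI).
    apply/eqP/setP => x; rewrite !inE; have [->|xv] /= := eqVneq x v.
      by apply/esym/negP => /ZB; rewrite eqxx.
    by case: (boolP (x \in Z)) => [/ZB /andP[_ ->] //|_]; rewrite andbF.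
  (* A set of the fibre without [v] is determined by its trace on [N], and these traces are exactly
     the subsets of [A]. *)
  rewrite (reindex_onto (fun Y => Z :|: Y) (fun W => W :&: N)) /=; last first.
    move=> W; rewrite inE => /andP[/andP[WI /eqP <-] vW]; apply/setP => x.
    rewrite !inE; have [->|xv] /= := eqVneq x v; first by rewrite (negbTE vW).
    by case: (x \in W); case: (e v x).
  apply: eq_bigl => Y; rewrite !inE.
  apply/idP/idP => [/andP[/andP[/andP[/independentP I _] _] /eqP YN]|YA].
    apply/subsetP => y yY; rewrite inE; apply/andP; split.
      by move: yY; rewrite -YN => /setIP[].
    by apply/forall_inP => z zZ; apply: I; rewrite inE ?yY ?zZ ?orbT.
  have YN : Y \subset N.
    by apply: (subset_trans YA); apply/subsetP => y; rewrite inE => /andP[].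
  have YZ y z : y \in Y -> z \in Z -> ~~ e y z.
    by move/(subsetP YA); rewrite inE => /andP[_ /forall_inP]; apply.
  have vZ : v \notin Z by apply/negP => /ZB; rewrite eqxx.
  have vY : v \notin Y by apply: contra vN; apply: (subsetP YN).
  rewrite negb_or vZ vY andbT /=; apply/andP; split; last first.
    apply/eqP/setP => x; rewrite !inE; case: (boolP (x \in Y)) => [/(subsetP YN)|].
      by rewrite orbT inE.
    by rewrite orbF; case: (boolP (x \in Z)) => //= /ZB /andP[_ /negbTE ->].
  rewrite andbT; apply/andP; split.
    apply/independentP => x y /setUP[xZ|xY] /setUP[yZ|yY].
    - exact: (independentP _ ZI).
    - by rewrite symE; apply: YZ.
    - exact: YZ.
    - by apply: (independentP _ NI); apply: (subsetP YN).
  apply/eqP/setP => x; rewrite !inE; have [->|xv] /= := eqVneq x v.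
    by rewrite (negbTE vZ).
  case: (boolP (x \in Z)) => [/ZB /andP[_ ->] //|_] /=.
  by apply/negP => /andP[xN /(subsetP YN)]; rewrite inE (negbTE xN).
rewrite !fiber; rewrite setU11 -!big_distrr /=.
rewrite (_ : \sum_(Y : {set V} | Y \subset A) 1 = 2 ^ #|A|); last first.
  by rewrite sum1_card -card_powerset; apply: eq_card => Y; rewrite powersetE.
have sY : \sum_(Y : {set V} | Y \subset A) #|Y| <=
   \sum_(Y : {set V} | Y \subset A) (d * (v \in Z :|: Y) + #|N :&: (Z :|: Y)|).
  apply: leq_sum => Y YA; apply: leq_trans (leq_addl _ _).
  apply/subset_leq_card/subsetP => y yY; move/(subsetP YA): (yY).
  by rewrite !inE yY orbT => /andP[->].
have h := neighbour_weight_bound #|A|; rewrite -sum_card_subset in h.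
apply: (leq_trans (leq_trans _ h)); first by rewrite mulnDr addnC.
rewrite muln1 mulnDr -addnA leq_add2l; apply: leq_trans (leq_addl _ _).
by rewrite mulnC -mulnA mulnC; apply: leq_mul.
Qed.

(** Sum [sum_neighbour_weight] over all [v]. A fixed independent set receives total weight at most
    [2 * d] per element: [d] from the element itself and at most [d] through its neighbours. A
    maximum independent set therefore bounds the average. *)
Lemma exists_large_independent :
  exists2 W, independent W & l * #|V| <= 8 * d * #|W|.
Proof.
have I0 : set0 \in [set W | independent W].
  by rewrite inE; apply/independentP => x y; rewrite inE.
pose W := [arg max_(W > set0 in [set W | independent W]) #|W|].
have [WI Wmax] : W \in [set W | independent W] /\
    forall W', W' \in [set W | independent W] -> #|W'| <= #|W|.
  by rewrite /W; case: arg_maxnP.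
exists W; first by rewrite inE in WI.
have I_gt0 : 0 < #|[set W | independent W]| by apply/card_gt0P; exists set0.
rewrite -(leq_pmul2r I_gt0).
apply: (@leq_trans (\sum_(v : V) l * #|[set W | independent W]|)).
  by rewrite sum_nat_const mulnCA mulnA.
apply: (leq_trans (leq_sum _ (fun v _ => sum_neighbour_weight v))).
rewrite -big_distrr /= exchange_big /= big_distrr /=.
rewrite [leqRHS]mulnC -sum_nat_const; apply: leq_sum => W' /Wmax W'W.
rewrite big_split /= -big_distrr /=.
have -> : \sum_v (v \in W') = #|W'| by rewrite -sum1_card [RHS]big_mkcond.
have : \sum_v #|[set y | e v y] :&: W'| <= d * #|W'|.
  apply: (@leq_trans (\sum_v \sum_(y in W') e v y)).
    apply: leq_sum => v _; rewrite -sum1_card big_mkcond [leqRHS]big_mkcond /=.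
    by apply: leq_sum => y _; rewrite !inE; case: (e v y); case: (y \in W').
  rewrite exchange_big /= mulnC -sum_nat_const; apply: leq_sum => y _.
  apply: leq_trans (degE y); rewrite -sum1_card [leqRHS]big_mkcond /=.
  by apply: leq_sum => v _; rewrite inE symE; case: (e y v).
have : d * #|W'| <= d * #|W| by rewrite leq_mul2l W'W orbT.
lia.
Qed.

End IndependentSet.

(** * The hypergraph of triangles on the edges of the complete graph *)

Section Triangles.
Import mathcomp.boot.fintype mathcomp.boot.finset.
Variable n : nat.
Implicit Types (s t I : {set 'I_n}) (e : edge n) (S : {set edge n}).
Local Open Scope nat_scope.

Definition clique t : {set edge n} := [set e : edge n | val e \subset t].

Definition triangles : {set {set edge n}} :=
  [set clique t | t in [set t : {set 'I_n} | #|t| == 3]].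

Lemma card_clique t : #|clique t| = 'C(#|t|, 2).
Proof.
rewrite -cards_draws -(card_imset (mem (clique t)) (@val_inj _ _ (edge n))).
apply: eq_card => A; apply/imsetP/idP => [[e]|].
  by rewrite !inE => et ->; rewrite et (valP e).
by rewrite inE => /andP[At A2]; exists (Sub A A2); rewrite ?inE !SubK.
Qed.

Lemma cliqueI s t : clique s :&: clique t = clique (s :&: t).
Proof. by apply/setP => e; rewrite !inE subsetI. Qed.

Lemma adjP S x y :
  reflect (exists2 e, e \in S & val e = [set x; y]) (adj S x y).
Proof. by apply: (iffP imsetP) => -[e eS eE]; exists e. Qed.

Lemma adjC S x y : adj S x y = adj S y x.
Proof. by rewrite /adj setUC. Qed.

Lemma card3_setI s t : #|s| == 3 -> #|t| == 3 -> s != t -> #|s :&: t| <= 2.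
Proof.
move=> /eqP s3 /eqP t3; apply: contraR; rewrite -ltnNge => st.
have /eqP <- : s :&: t == s by rewrite eqEcard subsetIl s3.
by rewrite eqEcard subsetIr t3.
Qed.

(** Two distinct triples share at most two vertices, which span at most one edge. *)
Lemma clique_lin s t : #|s| == 3 -> #|t| == 3 -> s != t ->
  #|clique s :&: clique t| <= 1.
Proof.
by move=> s3 t3 st; rewrite cliqueI card_clique -[1]/('C(2, 2)) leq_bin2l // card3_setI.
Qed.

Lemma clique_inj : {in [set t : {set 'I_n} | #|t| == 3] &, injective clique}.
Proof.
move=> s t; rewrite !inE => s3 t3 st; apply/eqP; apply: contraT => /(clique_lin s3 t3).
by rewrite st setIid card_clique (eqP t3).
Qed.

Lemma card_triangles : #|triangles| = 'C(n, 3).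
Proof.
rewrite card_in_imset; last exact: clique_inj.
rewrite -[in RHS](card_ord n) -cardsT -cards_draws.
by apply: eq_card => t; rewrite !inE subsetT.
Qed.

Lemma triangles_uniform T : T \in triangles -> #|T| = 3.
Proof. by case/imsetP => t; rewrite inE => /eqP t3 ->; rewrite card_clique t3. Qed.

(** A triangle through [e] is determined by its third vertex. *)
Lemma triangles_degree e : #|[set T in triangles | e \in T]| <= n.
Proof.
rewrite -[leqRHS](card_ord n) -cardsT.
apply: leq_trans (leq_imset_card (fun v => clique (v |: val e)) _).
apply/subset_leq_card/subsetP => T; rewrite inE => /andP[/imsetP[t]].
rewrite !inE => /eqP t3 ->; rewrite inE => et.
have : #|t :\: val e| == 1 by rewrite cardsD (setIidPr et) t3 (eqP (valP e)).
case/cards1P => v tv; apply/imsetP; exists v => //; congr clique.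
rewrite -tv; apply/setP => x; rewrite !inE.
by case: (boolP (x \in val e)) => [/(subsetP et) ->|_] //=; rewrite orbF.
Qed.

Lemma triangles_linear :
  {in triangles &, forall T T', T != T' -> #|T :&: T'| <= 1}.
Proof.
move=> _ _ /imsetP[s s3 ->] /imsetP[t t3 ->]; rewrite !inE in s3 t3.
move=> st; apply: clique_lin => //; apply: contra st => /eqP -> //.
Qed.

Lemma triangle_freeE : triangle_free n = avoiding triangles.
Proof.
apply/setP => S; rewrite !inE -negb_exists_in; congr (~~ _).
apply/idP/exists_inP => [/existsP[x /existsP[y /existsP[z /and3P[xy yz xz]]]]|].
  have xyN := adj_neq xy; have yzN := adj_neq yz; have xzN := adj_neq xz.
  exists (clique [set x; y; z]).
    apply: imset_f; rewrite inE setUC cardsU1 cards2 xyN !inE negb_or.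
    by rewrite ![z == _]eq_sym xzN yzN.
  apply/subsetP => e; rewrite inE => exyz.
  case/cards2P: (valP e) => a [b [ab eab]].
  suff /adjP[e' e'S] : adj S a b by rewrite -eab => /val_inj <-.
  have aI : a \in [set x; y; z] by apply: (subsetP exyz); rewrite eab !inE eqxx.
  have : b \in [set x; y; z] by apply: (subsetP exyz); rewrite eab !inE eqxx orbT.
  move: aI; rewrite !inE -!orbA => /or3P[] /eqP aE /or3P[] /eqP bE;
    by move: ab; rewrite aE bE ?eqxx // adjC.
case=> _ /imsetP[t + ->]; rewrite inE => /eqP t3 /subsetP tS.
have /card_gt2P[x [y [z [[xt yt zt] [xy yz zx]]]]] : 2 < #|t| by rewrite t3.
have tadj a b : a \in t -> b \in t -> a != b -> adj S a b.
  move=> at_ bt ab; have ab2 : #|[set a; b]| == 2 by rewrite cards2 ab.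
  apply/adjP; exists (Sub [set a; b] ab2 : edge n); last by rewrite SubK.
  by apply: tS; rewrite inE SubK subUset !sub1set at_.
apply/existsP; exists x; apply/existsP; exists y; apply/existsP; exists z.
by rewrite !tadj // eq_sym.
Qed.

(** Makes the complements of cliques a cover as soon as every triangle-free graph has an independent
    set of the required order. *)
Lemma clique_cover S I : {in I &, forall x y, ~~ adj S x y} ->
  S \subset ~: clique I.
Proof.
move=> IS; rewrite -disjoints_subset; apply/pred0P => e /=; apply/negP.
rewrite inE => /andP[eS eI]; case/cards2P: (valP e) => a [b [ab eab]].
have /negP : ~~ adj S a b.
  by apply: IS; apply: (subsetP eI); rewrite eab !inE eqxx ?orbT.
by apply; apply/adjP; exists e.
Qed.

End Triangles.

(** * The three thresholds are attained *)

Section Attained.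
Local Open Scope classical_set_scope.
Variables (R : realType) (X : finType).
Implicit Types (p : R) (S T : {set X}) (F G : {set {set X}}).

(** By the extreme value theorem the minimum exists, so [xget] returns it and not its default 0. *)
Lemma least_compact (A : set R) (T : topologicalType) (C : set T) (f : T -> R) :
  C !=set0 -> compact C -> continuous f -> A = f @` C ->
  A (least A) /\ lbound A (least A).
Proof.
move=> C0 cC cf ->; have fC : {within C, continuous f} by exact: continuous_subspaceT.
have [c cinC cmin] := compact_EVT_min C0 cC fC.
suff : exists x, ((f @` C) `&` lbound (f @` C)) x by move/(xgetPex 0) => [].
exists (f c); split; first by exists c => //; rewrite inE in cinC.
by move=> _ [t Ct <-]; apply: cmin; rewrite inE.
Qed.

Lemma continuous_sum (T : topologicalType) (I : finType) (P : pred I)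
    (f : I -> T -> R) :
  (forall i, continuous (f i)) -> continuous (fun x => \sum_(i | P i) f i x).
Proof.
move=> cf; apply: continuous_big => [|i _]; last exact: cf.
exact: add_continuous.
Qed.

Lemma continuous_mul (T : topologicalType) (f g : T -> R) :
  continuous f -> continuous g -> continuous (fun x => f x * g x).
Proof. by move=> cf cg x; apply: cvgM; [exact: cf|exact: cg]. Qed.

Lemma continuous_onem_exp (T : topologicalType) (f : T -> R) k :
  continuous f -> continuous (fun x => (1 - f x) ^+ k).
Proof.
move=> cf x; apply: (@continuous_comp _ _ _ (fun x => 1 - f x) (fun y => y ^+ k)).
  by apply: cvgB; [exact: cvg_cst|exact: cf].
exact: exprn_continuous.
Qed.

Lemma continuous_mu F : continuous (fun p => mu p F).
Proof.
apply: continuous_sum => S; apply: continuous_mul.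
  exact: exprn_continuous.
by apply: continuous_onem_exp => x.
Qed.

(** Only the full set has exponent 0, so every other term is a positive power of 0. *)
Lemma sum_full_notin F : [set: X]%SET \notin F ->
  \sum_(S in F) (1 - 1) ^+ #|~: S|%SET = 0 :> R.
Proof.
move=> FT; apply: big1 => S SF; rewrite subrr expr0n cards_eq0.
case: eqP => // /(congr1 (@finset.setC X)); rewrite finset.setCK finset.setC0 => ST.
by rewrite -ST SF in FT.
Qed.

Lemma p_small_1 F : [set: X]%SET \notin F -> p_small F (1 : R).
Proof.
move=> FT; exists F; split; last by rewrite sum_full_notin // invr_ge0.
by move=> S SF; exists S.
Qed.

Lemma p_small_weakly F p : p_small F p -> weakly_p_small F p.
Proof.
case=> G [GF Gp]; exists (fun T => (T \in G)%:R); split=> [T|S /GF[T TG ST]|].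
- by rewrite ler0n.
- by rewrite (bigD1 T) //= TG lerDl; apply: sumr_ge0 => T' _; rewrite ler0n.
- apply: le_trans Gp; rewrite [leRHS]big_mkcond /=; apply: ler_sum => T _.
  by case: ifP => _; rewrite ?mul1r ?mul0r.
Qed.

(** The admissible [p] form a finite union, over the covers [G], of closed subsets of the unit
    interval; this compact set contains 1. *)
Lemma expectation_thresholdP F : [set: X]%SET \notin F ->
  let A := [set p : R | 0 <= p <= 1 /\ p_small F p] in
  A (expectation_threshold R F) /\ lbound A (expectation_threshold R F).
Proof.
move=> FT A.
pose B G := [set p : R | 0 <= p <= 1 /\ \sum_(S in G) (1 - p) ^+ #|~: S|%SET <= 2^-1].
pose cov := [set G : {set {set X}} |
  forall S, S \in F -> exists2 T, T \in G & S \subset T].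
have I01 : [set p : R | 0 <= p <= 1] = `[0, 1]%classic.
  by apply/seteqP; split => x /=; rewrite in_itv.
apply: (@least_compact _ _ A id) => //; last by rewrite image_id.
  exists 1; split; first by rewrite lexx ler01.
  exact: p_small_1.
apply: (@subclosed_compact _ A `[(0:R), 1]%classic); last first.
- by rewrite -I01 => p [].
- exact: segment_compact.
rewrite (_ : A = \bigcup_(G in cov) B G); last first.
  apply/seteqP; split => p; first by move=> [p01 [G [GF Gp]]]; exists G.
  by move=> [G GF [p01 Gp]]; split => //; exists G.
apply: closed_bigcup => [|G _]; first exact: finite_finset.
rewrite (_ : B G = `[0, 1]%classic `&`
  (fun p : R => \sum_(S in G) (1 - p) ^+ #|~: S|%SET) @^-1` [set x | x <= 2^-1]);
  last by rewrite -I01.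
apply: closedI; first exact: interval_closed.
apply: (continuous_closedP _).1; last exact: closed_le.
by apply: continuous_sum => S; apply: continuous_onem_exp => x.
by move=> x; exact: cvg_id.
Qed.

(** The feasible pairs of a weight and a [p] form a closed subset of a cube, compact by Tychonoff's
    theorem, and the admissible [p] are its image under a projection. *)
Lemma fractional_expectation_thresholdP F : [set: X]%SET \notin F ->
  let A := [set p : R | 0 <= p <= 1 /\ weakly_p_small F p] in
  A (fractional_expectation_threshold R F) /\
  lbound A (fractional_expectation_threshold R F).
Proof.
move=> FT A.
(* The coordinate [None] holds [p], and [Some T] holds [g T]. *)
have pr i : continuous (fun f : {ptws option {set X} -> R} => f i).
  exact: (@proj_continuous _ (fun=> R) i).
pose K := [set f : {ptws option {set X} -> R} | forall i, `[0, 1]%classic (f i)].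
have cK : compact K.
  exact: (@tychonoff _ (fun=> R) (fun=> `[0, 1]%classic) (fun=> @segment_compact R 0 1)).
pose C1 := \bigcap_(S in [set S | S \in F])
  ((fun f : {ptws option {set X} -> R} => \sum_(T : {set X} | S \subset T) f (Some T))
    @^-1` [set x | 1 <= x]).
pose C2 := (fun f : {ptws option {set X} -> R} =>
    \sum_(T : {set X}) f (Some T) * (1 - f None) ^+ #|~: T|%SET)
  @^-1` [set x | x <= 2^-1].
have C1cl : closed C1.
  apply: closed_bigI => S _; apply: (continuous_closedP _).1; last exact: closed_ge.
  by apply: continuous_sum => T; exact: pr.
have C2cl : closed C2.
  apply: (continuous_closedP _).1; last exact: closed_le.
  apply: continuous_sum => T; apply: continuous_mul; first exact: pr.
  by apply: continuous_onem_exp; exact: pr.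
have cC : compact (K `&` (C1 `&` C2)) by apply: compact_closedI => //; exact: closedI.
have AE : A = (fun f : {ptws option {set X} -> R} => f None) @` (K `&` (C1 `&` C2)).
  apply/seteqP; split => [p [p01 [g [g0 gF gp]]]|_ [f [fK [fF fp]] <-]].
    (* Truncating weights at 1 puts them in the cube and lowers the cost. Each [S] stays covered:
       either one superset already has weight 1, or no weight above [S] was changed. *)
    pose f i : R := if i is Some T then Num.min (g T) 1 else p.
    exists f => //; split=> [[T|]|]; rewrite /= ?in_itv //=.
      by rewrite le_min g0 ler01 ge_min lexx orbT.
    split=> [S /= SF|].
      have [|/existsPn g1] := boolP [exists T : {set X}, (S \subset T) && (1 <= g T)].
        move=> /existsP[T /andP[ST gT]]; rewrite (bigD1 T) //= (min_r gT) lerDl.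
        by apply: sumr_ge0 => T' _; rewrite le_min g0 ler01.
      apply: (le_trans (gF S SF)); apply: ler_sum => T ST.
      by have := g1 T; rewrite ST /= -ltNge => /ltW gT; rewrite min_l.
    apply: le_trans gp; apply: ler_sum => T _ /=.
    apply: ler_wpM2r; last by rewrite ge_min lexx.
    by rewrite exprn_ge0 // subr_ge0; case/andP: p01.
  split; first by have := fK None; rewrite /= in_itv.
  exists (fun T => f (Some T)); split => // T.
  by have := fK (Some T); rewrite /= in_itv => /andP[].
apply: (least_compact _ cC (pr None) AE).
suff : A 1 by rewrite AE => -[f Cf _]; exists f.
by split; [rewrite lexx ler01|exact: p_small_weakly (p_small_1 FT)].
Qed.

(** The intermediate value theorem, between the values 1 at [p = 0] and 0 at [p = 1]. *)
Lemma thresholdP F : finset.set0 \in F -> [set: X]%SET \notin F ->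
  0 <= threshold R F <= 1 /\ mu (threshold R F) F = 2^-1.
Proof.
move=> F0 FT; apply: (@xgetPex _ 0 [set p | 0 <= p <= 1 /\ mu p F = 2^-1]).
have mu0 : mu (0 : R) F = 1.
  rewrite /mu (bigD1 finset.set0) //= cards0 expr0 mul1r subr0 expr1n.
  by rewrite big1 ?addr0 // => S /andP[_ S0]; rewrite expr0n cards_eq0 (negbTE S0) mul0r.
have mu1 : mu (1 : R) F = 0.
  rewrite /mu -[RHS](sum_full_notin FT); apply: eq_bigr => S _.
  by rewrite expr1n mul1r.
have cmu : {within `[0, 1], continuous (fun p => mu p F)}.
  by apply: continuous_subspaceT; exact: continuous_mu.
have [|p p01 pF] := @IVT R (fun p => mu p F) 0 1 2^-1 ler01 cmu.
  by rewrite mu0 mu1 (min_r ler01) (max_l ler01); lra.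
by exists p; split => //; rewrite in_itv in p01.
Qed.

End Attained.

(** * Explicit bounds for triangle-free graphs *)

Section Bounds.
Import mathcomp.boot.fintype mathcomp.boot.finset.
Variable R : realType.

Lemma triangle_free_set0 n : set0 \in triangle_free n.
Proof.
case/set0Pn: (triangle_free_neq0 n) => S SF.
exact: (triangle_free_down_set (sub0set S)).
Qed.

Lemma triangle_free_setT n : (2 < n)%N -> [set: edge n] \notin triangle_free n.
Proof.
move=> n3; apply: contra (triangle_free_neqT n3) => FT; apply/eqP/setP => S.
by rewrite [RHS]inE (triangle_free_down_set (subsetT S) FT).
Qed.

Lemma triangle_freeP n (S : {set edge n}) x y z : S \in triangle_free n ->
  adj S x y -> adj S y z -> adj S x z -> False.
Proof.
rewrite inE => /negP SF xy yz xz; apply: SF.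
by apply/existsP; exists x; apply/existsP; exists y; apply/existsP; exists z;
  rewrite xy yz.
Qed.

Lemma bin3E n : (6 * 'C(n.+2, 3) = n.+2 * (n.+1 * n))%N.
Proof.
have := mul_bin_diag n.+2 2; have := mul_bin_diag n.+1 1; rewrite /= bin1; lia.
Qed.

Lemma fractional_threshold_ge n : (2 < n)%N ->
  8^-1 / Num.sqrt n%:R <= fractional_expectation_threshold R (triangle_free n).
Proof.
move=> n3; have [[p01 wp] _] :=
  @fractional_expectation_thresholdP R _ _ (triangle_free_setT n3).
rewrite leNgt; apply/negP => ltp; move: wp; rewrite triangle_freeE.
have n1 : 1 <= n%:R :> R by rewrite ler1n; lia.
set s := Num.sqrt n%:R in ltp.
have s2 : s ^+ 2 = n%:R by rewrite sqr_sqrtr.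
have s1 : 1 <= s by rewrite -sqrtr1 ler_wsqrtr.
have s0 : 0 < s by lra.
have i1 : s^-1 <= 1 by rewrite invf_le1.
have i0 : 0 < s^-1 by rewrite invr_gt0.
have si : s * s^-1 = 1 by rewrite divff // gt_eqF.
(* This density turns the degree condition [16 * n * q ^ 2 <= 1] into an equality; its half is the
   claimed bound. *)
apply: (@avoiding_not_weakly_small R _ (triangles n) n _ _ (s^-1 / 4)).
- exact: triangles_uniform.
- exact: triangles_degree.
- lra.
- rewrite -s2; have -> : 16 * s ^+ 2 * (s^-1 / 4) ^+ 2 = (s * s^-1) ^+ 2.
    by field; rewrite gt_eqF.
  by rewrite si expr1n.
- by rewrite -triangle_freeE; apply: ltW; apply: lt_le_trans ltp _; lra.
Qed.

Lemma fractional_threshold_le n : (2 < n)%N ->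
  fractional_expectation_threshold R (triangle_free n) <=
  expectation_threshold R (triangle_free n).
Proof.
move=> /triangle_free_setT FT.
have [[p01 pF] _] := @expectation_thresholdP R _ _ FT.
have [_ lb] := @fractional_expectation_thresholdP R _ _ FT.
by apply: lb; split => //; exact: p_small_weakly.
Qed.

Lemma threshold_ge n : (2 < n)%N ->
  2^-1 / n%:R <= threshold R (triangle_free n).
Proof.
move=> n3; have [/andP[p0 p1]] :=
  @thresholdP R _ _ (triangle_free_set0 n) (triangle_free_setT n3).
set p := threshold R _ in p0 p1 *; rewrite {1}triangle_freeE => mup.
have p01 : 0 <= p <= 1 by rewrite p0.
have := mu_avoiding_ge (@triangles_uniform n) p01; rewrite mup card_triangles.
have n0 : 0 < n%:R :> R by rewrite ltr0n; lia.
have bn : 'C(n, 3)%:R <= n%:R ^+ 3 :> R.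
  rewrite -natrX ler_nat; case: n n3 {p p0 p1 mup p01 n0} => [|[|n]] // _.
  have := bin3E n; rewrite expnS expnS expn1; nia.
move=> h; rewrite ler_pdivrMr //; have := ler_wpM2r (exprn_ge0 3 p0) bn.
rewrite -exprMn; set y := n%:R * p; rewrite [p * _]mulrC -/y => h2.
have y0 : 0 <= y by rewrite mulr_ge0 // ltW.
(* The expected number of triangles is at least [1/2] by the first moment bound, but would be at
   most [1/8] here. *)
rewrite leNgt; apply/negP => y2; have : y ^+ 3 <= (2^-1) ^+ 3.
  by rewrite lerXn2r ?nnegrE // ltW.
lra.
Qed.

Lemma threshold_le n : (53 < n)%N ->
  threshold R (triangle_free n) <= 6 / n%:R.
Proof.
move=> n54; have n3 : (2 < n)%N by lia.
have [/andP[p0 p1]] :=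
  @thresholdP R _ _ (triangle_free_set0 n) (triangle_free_setT n3).
set p := threshold R _ in p0 p1 *; rewrite {1}triangle_freeE => mup.
have nr : 54 <= n%:R :> R by rewrite (ler_nat R 54).
have n0 : 0 < n%:R :> R by lra.
(* Suppose [y = n * p > 6]. The second moment bound gives [N * p ^ 3 <= 2 + 6 * n * p ^ 2]; with
   [n ^ 3 <= 27 * N] and [54 <= n] this becomes [y ^ 3 <= 54 + 3 * y ^ 2], whereas
   [y ^ 3 > 6 * y ^ 2] and [y ^ 2 > 36]. *)
rewrite ler_pdivlMr // leNgt; apply/negP; rewrite mulrC.
set y := n%:R * p => y6.
have p0' : 0 < p by move: y6; rewrite -(pmulr_rgt0 _ n0) -/y; lra.
have p01 : 0 < p <= 1 by rewrite p0'.
have := mu_avoiding_le (@triangles_uniform n) (@triangles_degree n)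
  (@triangles_linear n) p01.
rewrite mup card_triangles; set N : R := 'C(n, 3)%:R => h.
have N27 : n%:R ^+ 3 <= 27 * N.
  rewrite /N -natrX -natrM ler_nat; move: n54; clear.
  case: n => [|[|n]] // n54.
  have := bin3E n; rewrite expnS expnS expn1; nia.
have n30 : 0 < n%:R ^+ 3 :> R by rewrite exprn_gt0.
have N0 : 0 < N by lra.
have h1 : N * p ^+ 3 <= 2 + 6 * n%:R * p ^+ 2.
  have Np0 : 0 < N * p ^+ 3 by rewrite mulr_gt0 ?exprn_gt0.
  rewrite -(ler_pM2l Np0).
  have -> : N * p ^+ 3 * (N * p ^+ 3) = 2 * ((N * p ^+ 3) ^+ 2 / 2) by field.
  have -> : N * p ^+ 3 * (2 + 6 * n%:R * p ^+ 2) =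
     2 * (N * (p ^+ 3 + 3 * n%:R * p ^+ 5)) by ring.
  by rewrite ler_pM2l.
have h2 : y ^+ 3 <= 27 * (2 + 6 * n%:R * p ^+ 2).
  apply: (@le_trans _ _ (27 * (N * p ^+ 3))); last by rewrite ler_pM2l.
  by rewrite mulrA /y exprMn ler_wpM2r // exprn_ge0.
have h3 : 54 * (n%:R * p ^+ 2) <= y ^+ 2.
  rewrite /y exprMn [n%:R ^+ 2]expr2 -[n%:R * n%:R * _]mulrA ler_wpM2r //.
  by rewrite mulr_ge0 ?exprn_ge0 // ltW.
have h4 : y ^+ 3 <= 54 + 3 * y ^+ 2.
  apply: le_trans h2 _; rewrite mulrDr; lra.
have : 0 < y ^+ 2 * (y - 6) by rewrite mulr_gt0 ?exprn_gt0; lra.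
have : 36 < y ^+ 2 by rewrite expr2; nra.
have -> : y ^+ 2 * (y - 6) = y ^+ 3 - 6 * y ^+ 2 by ring.
lra.
Qed.

Lemma p_small_cliques n k (p : R) : 0 <= p <= 1 ->
  (forall S, S \in triangle_free n ->
    exists2 I : {set 'I_n}, #|I| = k & {in I &, forall x y, ~~ adj S x y}) ->
  'C(n, k)%:R * (1 - p) ^+ 'C(k, 2) <= 2^-1 -> p_small (triangle_free n) p.
Proof.
move=> /andP[p0 p1] indep bnd.
exists [set ~: clique I | I in [set I : {set 'I_n} | #|I| == k]]; split.
  move=> S /indep[I Ik SI]; exists (~: clique I); last exact: clique_cover.
  by apply: imset_f; rewrite inE Ik.
apply: le_trans bnd.
(* Distinct [I] may give the same clique when [k] is small, so the sum over the cover is only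
   bounded by the sum over [I]. *)
apply: (@le_trans _ _ (\sum_(I : {set 'I_n} | #|I| == k) (1 - p) ^+ 'C(k, 2))).
  rewrite [leRHS](partition_big (fun I => ~: clique I)
    (mem [set ~: clique I | I in [set I : {set 'I_n} | #|I| == k]])) /=; last first.
    by move=> I Ik; apply: imset_f; rewrite inE.
  apply: ler_sum => T /imsetP[I]; rewrite inE => Ik ->.
  rewrite (bigD1 I) /= ?Ik ?eqxx // setCK card_clique (eqP Ik) lerDl.
  by apply: sumr_ge0 => J _; rewrite exprn_ge0 // subr_ge0.
rewrite (eq_bigl (mem [set I : {set 'I_n} |
  (I \subset [set: 'I_n]) && (#|I| == k)])) => [|I];
  last by rewrite !inE subsetT.
by rewrite sumr_const cards_draws cardsT card_ord mulr_natl.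
Qed.

Lemma triangle_free_independent n k l (S : {set edge n}) :
  (4 ^ l <= k)%N -> (8 * k ^ 2 <= l * n)%N -> S \in triangle_free n ->
  exists2 I : {set 'I_n}, #|I| = k & {in I &, forall x y, ~~ adj S x y}.
Proof.
move=> lk kn SF.
suff [W kW WI] : exists2 W : {set 'I_n}, (k <= #|W|)%N &
    {in W &, forall x y, ~~ adj S x y}.
  have : (0 < #|[set A : {set 'I_n} | (A \subset W) && (#|A| == k)]|)%N.
    by rewrite cards_draws bin_gt0.
  case/card_gt0P => I; rewrite inE => /andP[/subsetP IW /eqP Ik].
  by exists I => // x y /IW xW /IW yW; exact: WI.
have k0 : (0 < k)%N by apply: leq_trans lk; rewrite expn_gt0.
(* A neighbourhood of order at least [k] is itself independent; otherwise all degrees are below [k]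
   and [exists_large_independent] applies with [d = k]. *)
case: (boolP [exists v, (k <= #|[set y | adj S v y]|)%N]) => [/existsP[v kv]|].
  exists [set y | adj S v y] => // x y; rewrite !inE => vx vy.
  by apply/negP => xy; exact: (triangle_freeP SF vx xy vy).
move/existsPn => deg.
have [||| |W /independentP WI kW] := @exists_large_independent _ (@adj n S) k l.
- exact: adjC.
- by move=> x y z; exact: triangle_freeP.
- by move=> v; rewrite ltnW // ltnNge; exact: deg.
- exact: lk.
exists W => //; rewrite card_ord in kW.
by have := leq_trans kn kW; rewrite expnS expn1 mulnA leq_pmul2l // muln_gt0.
Qed.

(** Take [l] about an eighth of the binary logarithm of [n], and [k] maximal with
    [8 * k ^ 2 <= l * n], hence of order [sqrt (n log n)]. *)
Lemma independence_parameters n : (256 <= n)%N -> exists k l,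
  [/\ (4 ^ l <= k)%N, (8 * k ^ 2 <= l * n)%N, (l * n <= 72 * k.-1 ^ 2)%N,
     (0 < l)%N & (trunc_log 2 n < 8 * l + 8)%N].
Proof.
move=> n256; set L := trunc_log 2 n; pose l := (L %/ 8)%N.
have L8 : (8 <= L)%N by apply: trunc_log_max.
have nL : (2 ^ L <= n)%N by apply: trunc_logP => //; lia.
have l0 : (0 < l)%N by rewrite divn_gt0.
pose P k := (8 * k ^ 2 <= l * n)%N.
have P0 : exists k, P k by exists 0%N.
have Pub k : P k -> (k <= l * n)%N.
  by rewrite /P expnS expn1; nia.
case: (ex_maxnP P0 Pub) => k Pk kmax; exists k, l.
have Pk1 : (l * n < 8 * k.+1 ^ 2)%N.
  by rewrite ltnNge; apply/negP => /kmax; rewrite ltnn.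
have lk : (4 ^ l <= k)%N.
  (* Otherwise [k.+1 ^ 2 <= 16 ^ l], while [n >= 256 ^ l], against [l * n < 8 * k.+1 ^ 2]. *)
  rewrite leqNgt; apply/negP => kl.
  have : (k.+1 ^ 2 <= 4 ^ l * 4 ^ l)%N by rewrite expnS expn1 leq_mul.
  have : (2 ^ (8 * l) <= n)%N.
    by apply: leq_trans nL; rewrite leq_exp2l // mulnC leq_trunc_div.
  rewrite -expnMn expnM -[(2 ^ 8)%N]/((4 * 4) * (4 * 4))%N expnMn.
  have : (4 * 4 <= (4 * 4) ^ l)%N by rewrite -[leqLHS]expn1 leq_exp2l.
  move: ((4 * 4) ^ l)%N => w; nia.
have k4 : (4 <= k)%N.
  by apply: leq_trans lk; rewrite -[leqLHS]expn1 leq_exp2l.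
split => //; last by rewrite /l; lia.
(* As [k >= 4], [k + 1 <= 3 * (k - 1)], whence the constant [72 = 8 * 9]. *)
case: k {kmax lk} Pk Pk1 k4 => // k _ h k4 /=; apply: ltnW.
apply: (leq_trans h); rewrite -!mulnn; nia.
Qed.

Lemma bin_le_exp n k : ('C(n, k) <= n ^ k)%N.
Proof.
apply: (@leq_trans (n ^_ k)); first by rewrite -bin_ffact leq_pmulr ?fact_gt0.
elim: k => [|k IHk] //; rewrite ffactnSr expnSr; apply: leq_mul => //.
exact: leq_subr.
Qed.

Lemma expectation_threshold_le n : (256 <= n)%N ->
  expectation_threshold R (triangle_free n) <= 136 * Num.sqrt (ln n%:R / n%:R).
Proof.
move=> n256; have n3 : (2 < n)%N by lia.
have [[/andP[q0 q1] qF] qmin] :=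
  @expectation_thresholdP R _ _ (triangle_free_setT n3).
set x : R := ln n%:R; set s := Num.sqrt _.
have n1 : 256 <= n%:R :> R by rewrite (ler_nat R 256).
have x0 : 0 <= x by rewrite ln_ge0; lra.
have s0 : 0 <= s by rewrite sqrtr_ge0.
have s2 : s ^+ 2 * n%:R = x.
  by rewrite sqr_sqrtr ?divr_ge0 // divfK // gt_eqF //; lra.
(* Beyond 1 the bound is trivial, since the threshold is at most 1. *)
have [p1|p1] := leP (136 * s) 1; last by apply: le_trans q1 (ltW p1).
apply: qmin; split; first by rewrite p1 mulr_ge0.
have [k [l [lk kn nk l0 Ll]]] := independence_parameters n256.
have p01 : 0 <= 136 * s <= 1 by rewrite p1 mulr_ge0.
apply: (p_small_cliques p01 (fun S => triangle_free_independent lk kn)).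
have k4 : (4 <= k)%N.
  by apply: leq_trans lk; rewrite -[leqLHS]expn1 leq_exp2l.
have nE : n%:R = expR x :> R by rewrite lnK // posrE; lra.
(* [n] is below [2 ^ (L + 1)], with [L] its binary logarithm, so
   [x <= L + 1 <= 8 * l + 8 <= 16 * l]. *)
have x16 : x <= 16 * l%:R.
  apply: (@le_trans _ _ (trunc_log 2 n).+1%:R); last first.
    by rewrite -natrM ler_nat; lia.
  rewrite -ler_expR -nE -[X in expR X]mulr1 expRM_natl.
  apply: (@le_trans _ _ (2 ^+ (trunc_log 2 n).+1)).
    by rewrite -natrX ler_nat ltnW // trunc_log_ltn.
  by apply: lerXn2r; rewrite ?nnegrE ?expR_ge0 //; exact: expR_ge1Dx.
set m : R := k.-1%:R.
have kE : k%:R = m + 1 :> R by rewrite /m natr1 prednK //; lia.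
have m3 : 3 <= m by rewrite /m (ler_nat R 3); lia.
have nx : n%:R * x <= 1152 * m ^+ 2.
  have : l%:R * n%:R <= 72 * m ^+ 2 :> R by rewrite /m -natrX -!natrM ler_nat.
  have : n%:R * x <= n%:R * (16 * l%:R) by rewrite ler_wpM2l //; lra.
  lra.
(* The square of the left side is [n * x], and [1152 = 16 * 72] is at most [34 ^ 2]; the constant
   [136] is [4 * 34]. *)
have sn : s * n%:R <= 34 * m.
  have m34 : 0 <= 34 * m by lra.
  rewrite -(@ler_pXn2r _ 2) ?nnegrE ?mulr_ge0 //.
  rewrite exprMn [n%:R ^+ 2]expr2 mulrA s2 mulrC exprMn; have := sqr_ge0 m; lra.
have xm : 4 * x <= 136 * s * m.
  have : s * (s * n%:R) <= s * (34 * m) by rewrite ler_wpM2l.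
  rewrite mulrA -expr2 s2; lra.
have CE : 2 * 'C(k, 2)%:R = (m + 1) * m :> R.
  by rewrite -kE -natrM -mul_bin_diag natrM bin1.
have e1 : (1 - 136 * s) ^+ 'C(k, 2) <= expR (- (136 * s) * 'C(k, 2)%:R).
  rewrite [_ * _%:R]mulrC expRM_natl; apply: lerXn2r; rewrite ?nnegrE ?expR_ge0 //.
    by rewrite subr_ge0.
  exact: expR_ge1Dx.
have e2 : 'C(n, k)%:R <= expR (k%:R * x) :> R.
  by rewrite expRM_natl -nE -natrX ler_nat bin_le_exp.
apply: (@le_trans _ _ (expR (k%:R * x) * expR (- (136 * s) * 'C(k, 2)%:R))).
  by apply: ler_pM => //; rewrite exprn_ge0 // subr_ge0.
(* By [xm] the second exponent is at most [- 2 * (m + 1) * x], so the total is at most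
   [- (m + 1) * x <= - x], and [expR (- x)] is the inverse of [n]. *)
rewrite -expRD; apply: (@le_trans _ _ (expR (- x))).
  rewrite ler_expR kE.
  have : (m + 1) * (4 * x) <= (m + 1) * (136 * s * m) by rewrite ler_wpM2l //; lra.
  have : 0 <= m * x by rewrite mulr_ge0 //; lra.
  have -> : (m + 1) * (136 * s * m) = 136 * s * ((m + 1) * m) by ring.
  rewrite -CE; lra.
by rewrite expRN -nE lef_pV2 ?posrE; lra.
Qed.

End Bounds.

(** * From explicit bounds to asymptotic notation *)

Section Asymptotics.
Variable R : realType.
Implicit Types f g : nat -> R.
Local Open Scope classical_set_scope.

Lemma eventually_bigO f g (k : R) N : 0 < k ->
  (forall n, (N <= n)%N -> 0 <= f n <= k * g n) -> f =O_\oo g.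
Proof.
move=> k0 fg; apply/eqO_exP; exists k => //; near=> n.
have /andP[f0 fkg] : 0 <= f n <= k * g n by apply: fg; near: n; exact: nbhs_infty_ge.
have g0 : 0 <= g n by rewrite -(pmulr_rge0 _ k0); exact: le_trans fkg.
by rewrite !ger0_norm.
Unshelve. all: by end_near. Qed.

Lemma eventually_bigOmega f g (k : R) N : 0 < k ->
  (forall n, (N <= n)%N -> 0 <= k * g n <= f n) -> f =Omega_\oo g.
Proof.
move=> k0 fg; rewrite eqOmegaE eqOmegaO.
have ki0 : 0 < k^-1 by rewrite invr_gt0.
apply: (@eventually_bigO g f k^-1 N ki0) => n /fg /andP[g0 gf].
rewrite pmulr_rge0 // in g0; rewrite g0 /=.
by rewrite -(ler_pM2l k0) mulrA divff ?mul1r // gt_eqF.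
Qed.

End Asymptotics.

Local Open Scope classical_set_scope.
Local Open Scope ring_scope.

Theorem theorem1p1 (R : realType) :
  let q : nat -> R := fun n => expectation_threshold R (triangle_free n) in
  let qf : nat -> R :=
    fun n => fractional_expectation_threshold R (triangle_free n) in
  let pc : nat -> R := fun n => threshold R (triangle_free n) in
  let lower : nat -> R := fun n => (Num.sqrt n%:R)^-1 in
  let upper : nat -> R := fun n => Num.sqrt (ln n%:R / n%:R) in
  [/\ q =Omega_\oo lower /\ q =O_\oo upper,
      qf =Omega_\oo lower /\ qf =O_\oo upper
    & pc =Theta_\oo (fun n => n%:R^-1 : R)].
Proof.
move=> q qf pc lower upper.
(* The chain [8^-1 * lower <= qf <= q <= 136 * upper] yields all four bounds on [q] and [qf]. *)
have low n : (2 < n)%N -> 0 <= 8^-1 * lower n <= qf n.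
  move=> n3; rewrite mulr_ge0 ?invr_ge0 ?sqrtr_ge0 //=.
  exact: fractional_threshold_ge.
have mid n : (2 < n)%N -> qf n <= q n by exact: fractional_threshold_le.
have up n : (256 <= n)%N -> q n <= 136 * upper n by exact: expectation_threshold_le.
have pos : 0 < (8 : R)^-1 by rewrite invr_gt0.
split; [split|split|].
- apply: (@eventually_bigOmega _ _ _ 8^-1 3) => // n n3.
  by have /andP[-> h] := low n n3; exact: le_trans h (mid n n3).
- apply: (@eventually_bigO _ _ _ 136 256) => // n n256.
  have n3 : (2 < n)%N by exact: leq_trans n256.
  have /andP[h0 h] := low n n3; rewrite up // andbT.
  exact: le_trans h0 (le_trans h (mid n n3)).
- exact: (@eventually_bigOmega _ _ _ 8^-1 3).
- apply: (@eventually_bigO _ _ _ 136 256) => // n n256.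
  have n3 : (2 < n)%N by exact: leq_trans n256.
  have /andP[h0 h] := low n n3; rewrite (le_trans h0 h) /=.
  exact: le_trans (mid n n3) (up n n256).
rewrite eqThetaE bigThetaE -eqOmegaE; split.
  apply: (@eventually_bigO _ _ _ 6 54) => // n n54.
  have n3 : (2 < n)%N by exact: leq_trans n54.
  rewrite [pc n <= _]threshold_le // andbT; apply: le_trans (threshold_ge R n3).
  by rewrite mulr_ge0 ?invr_ge0.
apply: (@eventually_bigOmega _ _ _ 2^-1 3) => [|n n3].
  by rewrite invr_gt0.
by rewrite mulr_ge0 ?invr_ge0 //=; exact: threshold_ge.
Qed.
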